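(* Let $\Omega\subset\mathbb{R}^N$ ($N\geq1$) be an open and bounded $BV$ extension domain. If $(u_n)_{n\ge1}\subset L^1(\Omega)$, $u\in L^1(\Omega)$ and $u_n\to u$ in $L^1(\Omega)$, then $$(\varepsilon,1)\text{-}\mathrm{Var}\,u\le\liminf_{n}\,(\varepsilon,1)\text{-}\mathrm{Var}\,u_n\qquad\text{for each }\varepsilon>0.$$
   Context: Functions are real-valued and elements of $L^1(\Omega)$ are identified when they agree Lebesgue-almost everywhere; $\|\cdot\|_1$ is the $L^1(\Omega)$-norm. When $N=1$, $\Omega$ is assumed to be an interval. Variation: for $u\in L^1(\Omega)$, $\mathrm{Var}\,u:=\sup\{\int_\Omega u\,\mathrm{div}\,\varphi\,dx \mid \varphi\in[C_c^1(\Omega)]^N,\ \|\varphi\|_\infty\le 1\}\in[0,\infty]$, and $BV(\Omega):=\{u\in L^1(\Omega)\mid \mathrm{Var}\,u<\infty\}$, a Banach space with norm $\|u\|_{BV}=\|u\|_1+\mathrm{Var}\,u$. $BV$ extension domain (Ambrosio–Fusco–Pallara, Definition 3.20): an open set $\Omega\subset\mathbb{R}^N$ with bounded boundary such that for every open set $A\supset\overline{\Omega}$ and every $m\ge1$ there is a linear continuous extension operator $T:[BV(\Omega)]^m\to[BV(\mathbb{R}^N)]^m$ (so $Tu=u$ a.e. in $\Omega$) with: $Tu=0$ a.e. in $\mathbb{R}^N\setminus A$ for all $u\in[BV(\Omega)]^m$; $|D(Tu)|(\partial\Omega)=0$ for all $u\in[BV(\Omega)]^m$; and for every $q\in[1,\infty]$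 the restriction of $T$ to $[W^{1,q}(\Omega)]^m$ is a linear continuous map into $[W^{1,q}(\mathbb{R}^N)]^m$. $(\varepsilon,1)$-variation: for $u\in L^1(\Omega)$ and $\varepsilon>0$, $(\varepsilon,1)\text{-}\mathrm{Var}\,u:=\inf\{\mathrm{Var}\,v\mid v\in BV(\Omega),\ \|u-v\|_1\le\varepsilon\}$, with the convention that the infimum over the empty set is $\infty$. *)

(* Defs.v *)
From HB Require Import structures.
From mathcomp Require Import all_boot all_order all_algebra.
From mathcomp Require Import all_classical all_reals all_analysis.
From mathcomp Require Import measurable_realfun.

Set Implicit Arguments.
Unset Strict Implicit.
Unset Printing Implicit Defensive.

Import Order.TTheory GRing.Theory Num.Theory.
Import numFieldNormedType.Exports.

Local Open Scope classical_set_scope.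
Local Open Scope ring_scope.

Section borel_rV.
Context {R : realType} {n : nat}.

Definition borel_rV : set (set 'rV[R]_n) := <<s open >>.

Let borel_rV0 : borel_rV set0.
Proof. exact: sigma_algebra0. Qed.

Let borel_rVC A : borel_rV A -> borel_rV (~` A).
Proof. exact: sigma_algebraC. Qed.

Let borel_rV_bigcup (F : (set 'rV[R]_n)^nat) :
  (forall i, borel_rV (F i)) -> borel_rV (\bigcup_i F i).
Proof. exact: sigma_algebra_bigcup. Qed.

HB.instance Definition _ := @isMeasurable.Build default_measure_display
  'rV[R]_n borel_rV borel_rV0 borel_rVC borel_rV_bigcup.

Lemma open_measurable_rV (U : set 'rV[R]_n) : open U -> measurable U.
Proof. by move=> oU; exact: sub_sigma_algebra. Qed.

Let qbox (p : 'rV[rat]_n * nat) : set 'rV[R]_n :=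
  [set x | forall i, `|ratr (p.1 ord0 i) - x ord0 i| < p.2.+1%:R^-1].

Let open_qbox (U : set 'rV[R]_n) : open U ->
  U = \bigcup_(p in [set p | qbox p `<=` U]) qbox p.
Proof.
move=> oU; apply/seteqP; split=> [x Ux|x [p pU px]]; last exact: pU.
have /nbhs_ballP[e /= e0 eU] : nbhs x U by exact: open_nbhs_nbhs.
have [k k0 ke] : exists2 k : nat, (0 < k)%N & k%:R^-1 < e / 2 :> R.
  have e20 : 0 < e / 2 by rewrite divr_gt0.
  exists (Num.truncn (e / 2)^-1).+1 => //.
  by rewrite invf_plt ?posrE ?ltr0n// truncnS_gt.
case: k => // k in k0 ke *.
have qP i : exists q : rat, `|ratr q - x ord0 i| < k.+1%:R^-1.
  have k0' : 0 < k.+1%:R^-1 :> R by rewrite invr_gt0 ltr0n.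
  have [q] : exists q, ratr q \in `](x ord0 i - k.+1%:R^-1), (x ord0 i + k.+1%:R^-1)[.
    by apply: rat_in_itvoo; rewrite ltrD2l gtrN.
  by rewrite in_itv/= => /andP[q1 q2]; exists q; rewrite ltr_distl q1.
pose q : 'rV[rat]_n := \row_i projT1 (cid (qP i)).
exists (q, k) => /=; last by move=> i; rewrite mxE; case: cid.
move=> y yq; apply: eU; split => // a i; rewrite [a]ord1.
have xq : `|ratr (q ord0 i) - x ord0 i| < k.+1%:R^-1.
  by rewrite mxE; case: cid.
rewrite /ball/= /ball_/= (le_lt_trans (ler_distD (ratr (q ord0 i)) _ _))//.
rewrite [ltRHS]splitr ltrD//; last exact: (lt_trans (yq i)).
by rewrite distrC (lt_trans xq).
Qed.

Lemma measurable_fun_rV d (T : measurableType d) (f : T -> 'rV[R]_n) :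
  (forall i, measurable_fun setT (fun t => f t ord0 i)) ->
  measurable_fun setT f.
Proof.
move=> mf; apply: (@measurability _ _ T _ setT f open) => //.
move=> _ [U oU <-]; rewrite setTI (open_qbox oU) preimage_bigcup bigcup_mkcond.
apply: countable_bigcupT_measurable => // p; case: ifPn => // _.
rewrite (_ : _ @^-1` _ = \bigcap_(i in setT)
    ((fun t => f t ord0 i) @^-1` ball (ratr (p.1 ord0 i) : R) p.2.+1%:R^-1)).
  apply: fin_bigcap_measurable; first exact: finite_finset.
  move=> i _; rewrite -[X in measurable X]setTI; apply: mf => //.
  by apply: open_measurable; exact: ball_open.
by apply/seteqP; split => [t pt i _|t pt i]; exact: pt.
Qed.

End borel_rV.

Section lebesgue_rV.
Context {R : realType}.

Lemma measurable_coord_rV n (i : 'I_n) :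
  measurable_fun setT (fun x : 'rV[R]_n => x ord0 i).
Proof.
apply: (@measurability _ _ _ _ setT _ (@RGenOInfty.G R)).
  exact: RGenOInfty.measurableE.
move=> _ [_ [a ->] <-]; rewrite setTI; apply: open_measurable_rV.
apply: open_comp; last exact: interval_open.
by move=> x _; exact: coord_continuous.
Qed.

Definition cons_rV n (p : R * 'rV[R]_n) : 'rV[R]_n.+1 :=
  row_mx (\row_(i < 1) p.1) p.2.

Let cons_rV_lshift n (p : R * 'rV[R]_n) (j : 'I_1) :
  cons_rV p ord0 (lshift n j) = p.1.
Proof. by rewrite [LHS](row_mxEl (\row_(i < 1) p.1)) mxE. Qed.

Let cons_rV_rshift n (p : R * 'rV[R]_n) j :
  cons_rV p ord0 (rshift 1 j) = p.2 ord0 j.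
Proof. exact: (row_mxEr (\row_(i < 1) p.1)). Qed.

Lemma measurable_cons_rV n : measurable_fun setT (@cons_rV n).
Proof.
apply: measurable_fun_rV => i.
case: (split_ordP (i : 'I_(1 + n))) => j ->.
  rewrite (_ : (fun t => _) = fst); first exact: measurable_fst.
  by apply/funext => p; exact: cons_rV_lshift.
rewrite (_ : (fun t => _) = (fun x : 'rV[R]_n => x ord0 j) \o snd); last first.
  by apply/funext => p; exact: cons_rV_rshift.
apply: (measurableT_comp (measurable_coord_rV j)).
exact: measurable_snd.
Qed.

Section step.
Variables (n : nat) (m : {sigma_finite_measure set 'rV[R]_n -> \bar R}).

Definition lebesgue_rV_step : set 'rV[R]_n.+1 -> \bar R :=
  pushforward (lebesgue_measure \x m)%E (@cons_rV n).

HB.instance Definition _ := Measure.copy lebesgue_rV_step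
  (measure_function_pushforward__canonical__measure_function_Measure
    (lebesgue_measure \x m)%E (@measurable_cons_rV n)).

Let sigma_finite_step : sigma_finite setT lebesgue_rV_step.
Proof.
pose uncons (x : 'rV[R]_n.+1) : measurableTypeR R * 'rV[R]_n :=
  (x ord0 ord0, \row_(i < n) x ord0 (lift ord0 i)).
have unconsK p : uncons (cons_rV p) = p.
  case: p => a v; rewrite /uncons; congr pair.
    rewrite -[RHS](cons_rV_lshift (a, v) ord0); congr (cons_rV _ _ _).
    exact/val_inj.
  apply/rowP => i; rewrite mxE /=.
  rewrite -[RHS](cons_rV_rshift (a, v) i); congr (cons_rV _ _ _); exact/val_inj.
have muncons : measurable_fun setT uncons.
  apply/measurable_fun_pair; first exact: measurable_coord_rV.
  apply: measurable_fun_rV => i; under eq_fun do rewrite mxE.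
  exact: measurable_coord_rV.
have /sigma_finiteP[F [TF ndF mF]] := sigma_finiteT (@lebesgue_measure R).
have /sigma_finiteP[G [TG ndG mG]] := sigma_finiteT m.
exists (fun k => uncons @^-1` (F k `*` G k)).
  rewrite -preimage_bigcup; apply/seteqP; split=> // x _ /=.
  have [i _ Fi] : (\bigcup_i F i) (uncons x).1 by rewrite -TF.
  have [j _ Gj] : (\bigcup_i G i) (uncons x).2 by rewrite -TG.
  exists (maxn i j) => //; split.
    exact/(subsetPset _ _ (ndF _ _ (leq_maxl i j))).
  exact/(subsetPset _ _ (ndG _ _ (leq_maxr i j))).
move=> k; have [[mFk Fkoo] [mGk Gkoo]] := (mF k, mG k); split.
  by rewrite -[X in measurable X]setTI; apply: muncons => //; exact: measurableX.
rewrite /lebesgue_rV_step /pushforward -comp_preimage.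
rewrite (_ : uncons \o _ = id); last by apply/funext => p /=; rewrite unconsK.
by rewrite preimage_id product_measure1E// lte_mul_pinfty// ge0_fin_numE.
Qed.

HB.instance Definition _ := Measure_isSigmaFinite.Build _ _ _
  lebesgue_rV_step sigma_finite_step.
End step.

(* Lebesgue measure on the Borel sets of [R^n], as the [n]-fold product of the
   one-dimensional one. *)
Fixpoint lebesgue_rV n : {sigma_finite_measure set 'rV[R]_n -> \bar R} :=
  if n is n'.+1 then lebesgue_rV_step (lebesgue_rV n') else \d_ (0 : 'rV[R]_0).

End lebesgue_rV.

Section variation.
Context {R : realType} {N : nat}.
Implicit Types (W : set 'rV[R]_N) (u v : 'rV[R]_N -> R) (q : \bar R).

Local Notation leb := (@lebesgue_rV R N).

(* [R^N] carries the library's sup norm; boundedness, openness, compactness and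
   differentiability do not depend on this, but the bound on test fields does. *)
Definition euclidean_norm (x : 'I_N -> R) : R :=
  Num.sqrt (\sum_(i < N) x i ^+ 2).

(* Functions in [C_c^1(W)] are identified with their extension by zero. *)
Definition C1c W (f : 'rV[R]_N -> R) : Prop :=
  [/\ continuous f,
      forall i x, derivable f x 'e_i,
      forall i, continuous ('D_'e_i f),
      compact (closure [set x | f x != 0])
    & closure [set x | f x != 0] `<=` W].

Definition divergence (phi : 'I_N -> 'rV[R]_N -> R) (x : 'rV[R]_N) : R :=
  \sum_(i < N) 'D_'e_i (phi i) x.

(* Elements of [L^q(W)] are represented by functions on [R^N], whose values
   outside [W] are irrelevant ([u \_ W] is [u] on [W] and [0] elsewhere). *)
Definition Lq_norm W q u : \bar R := 'N[leb]_q[EFin \o (u \_ W)]%E.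

Definition Lq W q u : Prop :=
  measurable_fun W u /\ (Lq_norm W q u < +oo)%E.

Definition Var W u : \bar R :=
  ereal_sup [set (\int[leb]_(x in W) (u x * divergence phi x)%:E)%E
    | phi in [set phi : 'I_N -> 'rV[R]_N -> R |
        (forall i, C1c W (phi i)) /\
        (forall x, euclidean_norm (phi ^~ x) <= 1)]].

Definition BV W u : Prop := Lq W 1 u /\ (Var W u < +oo)%E.

Definition BV_norm W u : \bar R := (Lq_norm W 1 u + Var W u)%E.

(* [ereal_inf set0 = +oo], so the value is [+oo] when no [v] is admissible. *)
Definition eps1_Var W (eps : R) u : \bar R :=
  ereal_inf [set Var W v
    | v in [set v | BV W v /\ (Lq_norm W 1 (u \- v)%R <= eps%:E)%E]].

Definition weak_partial W (i : 'I_N) u (g : 'rV[R]_N -> R) : Prop :=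
  forall phi, C1c W phi ->
    (\int[leb]_(x in W) (u x * 'D_'e_i phi x)%:E =
     - \int[leb]_(x in W) (g x * phi x)%:E)%E.

(* [u] belongs to [W^{1,q}(W)] and has weak gradient [g] *)
Definition W1q_with_grad W q u (g : 'I_N -> 'rV[R]_N -> R) : Prop :=
  Lq W q u /\ forall i, Lq W q (g i) /\ weak_partial W i u (g i).

Definition W1q_norm W q u (g : 'I_N -> 'rV[R]_N -> R) : \bar R :=
  (Lq_norm W q u + \sum_(i < N) Lq_norm W q (g i))%E.

(* Integral against a signed measure, through its Jordan decomposition. *)
Definition charge_integral (nu : {charge set 'rV[R]_N -> \bar R})
    (f : 'rV[R]_N -> \bar R) : \bar R :=
  let: exist _ exN := cid (Hahn_decomposition nu) in
  let: exist _ nuPN := cid exN in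
  (\int[jordan_pos nuPN]_x f x - \int[jordan_neg nuPN]_x f x)%E.

(* [nu] is the matrix-valued measure [D w] for [w : R^N -> R^m] *)
Definition is_derivative_measure m (w : 'I_m -> 'rV[R]_N -> R)
    (nu : 'I_m -> 'I_N -> {charge set 'rV[R]_N -> \bar R}) : Prop :=
  forall a i phi, C1c setT phi ->
    (\int[leb]_x (w a x * 'D_'e_i phi x)%:E =
     - charge_integral (nu a i) (EFin \o phi))%E.

(* Total variation of a matrix-valued measure: the supremum of
   [\sum_h |nu (E_h)|] over the countable Borel partitions of [B]. *)
Definition total_variation m
    (nu : 'I_m -> 'I_N -> {charge set 'rV[R]_N -> \bar R})
    (B : set 'rV[R]_N) : \bar R :=
  ereal_sup [set (\sum_(0 <= h <oo)
      (Num.sqrt (\sum_(a < m) \sum_(i < N) fine (nu a i (E h)) ^+ 2))%:E)%E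
    | E in [set E : (set 'rV[R]_N)^nat |
        [/\ forall h, measurable (E h), trivIset setT E & \bigcup_h E h = B]]].

Definition boundary W : set 'rV[R]_N := closure W `\` W°.

(* [T] is a linear continuous extension operator from [BV(W)^m] to [BV(R^N)^m],
   acting on representatives. Since [U = V] a.e. in [W] means that
   [BV_norm W (U - V) = 0], linearity and boundedness make [T] well defined on
   classes. The product norm used on the [m]-fold powers is the sum. *)
Definition BV_extension_operator W m
    (T : ('I_m -> 'rV[R]_N -> R) -> 'I_m -> 'rV[R]_N -> R) : Prop :=
  [/\ forall U, (forall a, BV W (U a)) -> forall a, BV setT (T U a),
      forall (c : R) U V, (forall a, BV W (U a)) -> (forall a, BV W (V a)) ->
        forall a, ae_eq leb setT (T (fun b x => c * U b x + V b x) a)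
                                 (fun x => c * T U a x + T V a x),
      exists C : R, forall U, (forall a, BV W (U a)) ->
        (\sum_(a < m) BV_norm setT (T U a)
           <= C%:E * \sum_(a < m) BV_norm W (U a))%E
    & forall U, (forall a, BV W (U a)) ->
        forall a, ae_eq leb W (T U a) (U a)].

(* The restriction of [T] to the functions of [W^{1,q}(W)^m] (in the domain
   [BV(W)^m] of [T], which is automatic when [W] is bounded) is continuous into
   [W^{1,q}(R^N)^m]. *)
Definition preserves_W1q W m
    (T : ('I_m -> 'rV[R]_N -> R) -> 'I_m -> 'rV[R]_N -> R) q : Prop :=
  exists C : R, forall U g,
    (forall a, BV W (U a)) -> (forall a, W1q_with_grad W q (U a) (g a)) ->
    exists2 G, forall a, W1q_with_grad setT q (T U a) (G a)
      & (\sum_(a < m) W1q_norm setT q (T U a) (G a)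
           <= C%:E * \sum_(a < m) W1q_norm W q (U a) (g a))%E.

Definition BV_extension_domain W : Prop :=
  [/\ open W, bounded_set (boundary W)
    & forall A, open A -> closure W `<=` A -> forall m, (0 < m)%N ->
      exists T : ('I_m -> 'rV[R]_N -> R) -> 'I_m -> 'rV[R]_N -> R,
      [/\ BV_extension_operator W T,
          forall U, (forall a, BV W (U a)) ->
            forall a, ae_eq leb (~` A) (T U a) (cst 0),
          forall U, (forall a, BV W (U a)) -> exists nu,
            is_derivative_measure (T U) nu /\
            total_variation nu (boundary W) = 0%E
        & forall q, (1 <= q)%E -> preserves_W1q W T q]].

End variation.

(* Main.v *)
Require Import Defs.
From HB Require Import structures.
From mathcomp Require Import all_boot all_order all_algebra.
From mathcomp Require Import all_classical all_reals all_analysis.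
From mathcomp Require Import finmap measurable_realfun ring lra.

(* No compactness is needed, because [(eps,1)-Var u] is a convex nonincreasing
   function of [eps], finite for every [eps > 0] since [BV] is dense in [L^1], hence
   continuous in [eps].  Concretely, fix [w] in [BV] with
   [||u - w||_1 <= eps / 2]; if [v] is admissible for [u_n] and
   [delta = ||u - u_n||_1], then [(1 - t) v + t w] with
   [t = delta / (eps / 2 + delta)] is admissible for [u], and its variation is
   at most [Var v + t Var w].  So
   [(eps,1)-Var u <= (eps,1)-Var u_n + O(delta)].

   Density: Lipschitz functions are dense in [L^1], and a bounded Lipschitz function
   has finite variation on a set of finite measure, as one sees by writing
   [D_i phi] as a limit of difference quotients and moving the increment onto
   the function by translation invariance of Lebesgue measure. *)

Set Implicit Arguments.
Unset Strict Implicit.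
Unset Printing Implicit Defensive.

Import Order.TTheory GRing.Theory Num.Theory.
Import numFieldNormedType.Exports HBSimple.

Local Open Scope classical_set_scope.
Local Open Scope ring_scope.

(** * Density in L1 *)

Section L1_density.
Context {d} {T : measurableType d} {R : realType}.
Variables (mu : {measure set T -> \bar R}) (D : set T).
Hypothesis mD : measurable D.

Definition L1_dist (f g : T -> R) : \bar R :=
  (\int[mu]_(x in D) `|f x - g x|%:E)%E.

Lemma measurable_L1_dist (f g : T -> R) :
  measurable_fun D f -> measurable_fun D g ->
  measurable_fun D (fun x => `|f x - g x|%:E).
Proof.
move=> mf mg; apply/measurable_EFinP; apply: measurableT_comp => //.
exact: measurable_funB.
Qed.

Lemma L1_distD (f g f' g' : T -> R) :
  measurable_fun D f -> measurable_fun D g ->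
  measurable_fun D f' -> measurable_fun D g' ->
  (L1_dist (f \+ f')%R (g \+ g')%R <= L1_dist f g + L1_dist f' g')%E.
Proof.
move=> mf mg mf' mg'; rewrite /L1_dist -ge0_integralD//=; [|exact: measurable_L1_dist..].
apply: ge0_le_integral => //=.
- by apply: measurable_L1_dist; exact: measurable_funD.
- by apply: emeasurable_funD; exact: measurable_L1_dist.
- by move=> x _; rewrite -EFinD lee_fin opprD addrACA ler_normD.
Qed.

Lemma L1_distZ (c : R) (f g : T -> R) :
  measurable_fun D f -> measurable_fun D g ->
  L1_dist (fun x => c * f x) (fun x => c * g x) = (`|c|%:E * L1_dist f g)%E.
Proof.
move=> mf mg; rewrite /L1_dist -ge0_integralZl_EFin//=; last exact: measurable_L1_dist.
by apply: eq_integral => x _; rewrite -mulrBr normrM EFinM.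
Qed.

Lemma L1_dist_triangle (g f h : T -> R) :
  measurable_fun D f -> measurable_fun D g -> measurable_fun D h ->
  (L1_dist f h <= L1_dist f g + L1_dist g h)%E.
Proof.
move=> mf mg mh; have := L1_distD mf mg mg mh; apply: le_trans.
apply: ge0_le_integral => //=.
- exact: measurable_L1_dist.
- by apply: measurable_L1_dist; exact: measurable_funD.
- by move=> x _; rewrite lee_fin opprD addrA addrK.
Qed.

Lemma L1_dist_ge0 f g : (0 <= L1_dist f g)%E.
Proof. by apply: integral_ge0 => x _; rewrite lee_fin. Qed.

(** Dominated convergence: a constant dominates, and it is integrable because [mu D] is finite. *)
Lemma bounded_cvg_L1 (f_ : nat -> T -> R) (f : T -> R) (C : R) :
  (mu D < +oo)%E ->
  (forall n, measurable_fun D (f_ n)) -> measurable_fun D f ->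
  (forall n x, D x -> `|f_ n x| <= C) ->
  (forall x, D x -> f_ ^~ x @ \oo --> f x) ->
  L1_dist f (f_ n) @[n --> \oo] --> 0%E.
Proof.
move=> Doo mf_ mf f_C f_f.
have [] := @dominated_convergence _ T R mu D mD (fun n x => (f_ n x)%:E)
  (EFin \o f) (cst C%:E).
- by move=> n; exact/measurable_EFinP.
- exact/measurable_EFinP.
- by apply: aeW => x Dx; apply: cvg_EFin; [exact: nearW|exact: f_f].
- apply/integrableP; split; first exact: measurable_cst.
  by rewrite integral_cst//= lte_mul_pinfty.
- by apply: aeW => x n Dx; rewrite lee_fin f_C.
move=> _ + _; apply: cvg_trans; apply: near_eq_cvg; apply: nearW => n /=.
by apply: eq_integral => x _; rewrite /= distrC.
Qed.

Variable V : set (T -> R).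
Hypothesis Vm : forall v, V v -> measurable_fun D v.
Hypothesis VD : forall v w, V v -> V w -> V (v \+ w).
Hypothesis VZ : forall (c : R) v, V v -> V (fun x => c * v x).

Definition L1_closure (f : T -> R) : Prop :=
  forall e : R, 0 < e -> exists2 v, V v & (L1_dist f v < e%:E)%E.

Lemma L1_closureD (f g : T -> R) :
  measurable_fun D f -> measurable_fun D g ->
  L1_closure f -> L1_closure g -> L1_closure (f \+ g).
Proof.
move=> mf mg cf cg e e0; have e20 : 0 < e / 2 by rewrite divr_gt0.
have [v Vv fv] := cf _ e20; have [w Vw gw] := cg _ e20.
exists (v \+ w); first exact: VD.
apply: (le_lt_trans (L1_distD mf (Vm Vv) mg (Vm Vw))).
by rewrite [e]splitr EFinD lteD.
Qed.

Lemma L1_closureZ (c : R) (f : T -> R) :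
  measurable_fun D f -> L1_closure f -> L1_closure (fun x => c * f x).
Proof.
move=> mf cf e e0.
have c0 : 0 < `|c| + 1 by rewrite ltr_wpDl.
have [v Vv fv] := cf _ (divr_gt0 e0 c0).
exists (fun x => c * v x); first exact: VZ.
rewrite L1_distZ//; last exact: Vm.
apply: (@le_lt_trans _ _ ((`|c| + 1)%:E * L1_dist f v)%E).
  by apply: lee_wpmul2r; [exact: L1_dist_ge0|rewrite lee_fin lerDl].
by rewrite muleC -lte_pdivlMr.
Qed.

Lemma L1_closure_cvg (f_ : nat -> T -> R) (f : T -> R) :
  (forall n, measurable_fun D (f_ n)) -> measurable_fun D f ->
  (forall n, L1_closure (f_ n)) -> L1_dist f (f_ n) @[n --> \oo] --> 0%E ->
  L1_closure f.
Proof.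
move=> mf_ mf cf_ ff e e0; have e20 : 0 < e / 2 by rewrite divr_gt0.
have : nbhs 0%E [set x : \bar R | (x < (e / 2)%:E)%E].
  by apply: open_ereal_lt'; rewrite lte_fin.
move=> /ff[n _ /(_ n (leqnn n)) /= fn].
have [v Vv fv] := cf_ n _ e20; exists v => //.
apply: (le_lt_trans (L1_dist_triangle mf (mf_ n) (Vm Vv))).
by rewrite [e]splitr EFinD lteD.
Qed.

(** * Density from a generating pi-system *)

Variable G : set (set T).
Hypothesis GE : @measurable _ T = <<s G >>.
Hypothesis GI : setI_closed G.
Hypothesis cT : L1_closure \1_setT.
Hypothesis cG : forall A, G A -> L1_closure \1_A.
Hypothesis Doo : (mu D < +oo)%E.

Let mindic (A : set T) : measurable A -> measurable_fun D (\1_A : T -> R).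
Proof. by move=> mA; exact: measurable_indic. Qed.

(** Dynkin's pi-lambda theorem: the sets whose indicator can be approximated contain the pi-system
    [G] and are stable under complements and countable disjoint unions. *)
Lemma L1_closure_indic (A : set T) : measurable A -> L1_closure \1_A.
Proof.
move=> mA; have : <<s G >> A by rewrite -GE.
apply: (@dynkin_induction _ T G (fun A => L1_closure \1_A)) => //.
  move=> S mS cS.
  rewrite (_ : \1_(~` S) = \1_setT \+ (fun x => (-1) * \1_S x)); last first.
    apply/funext => x; rewrite /= !indicE in_setT in_setC mulN1r.
    by case: (x \in S); rewrite /= ?subrr ?subr0.
  apply: L1_closureD => //.
    by apply: measurable_funM => //; exact: mindic.
  by apply: L1_closureZ => //; exact: mindic.
move=> F mF tF cF.
have mU n : measurable (\big[setU/set0]_(i < n) F i) by exact: bigsetU_measurable.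
have mUF : measurable (\bigcup_k F k) by exact: bigcup_measurable.
apply: (@L1_closure_cvg (fun n => \1_(\big[setU/set0]_(i < n) F i))).
- by move=> n; exact: mindic.
- exact: mindic.
- elim => [|n IH].
    (* The zero function is reached as 0 times the constant 1, which [cT] puts in the closure. *)
    rewrite big_ord0 (_ : \1_set0 = (fun x => 0 * \1_setT x)); last first.
      by apply/funext => x; rewrite indic0/= mul0r.
    by apply: L1_closureZ => //; exact: mindic.
  rewrite big_ord_recr/= (_ : \1_(_ `|` F n) =
      (\1_(\big[setU/set0]_(i < n) F i) \+ \1_(F n) : T -> R)).
    by apply: L1_closureD => //; exact: mindic.
  apply/funext => x; rewrite /= !indicE in_setU.
  have [/set_mem|_] := boolP (x \in _); last by rewrite add0r.
  rewrite -bigcup_mkord => -[k /= kn Fkx]; rewrite memNset ?addr0// => Fnx.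
  have kEn : k = n by apply: tF => //; exists x.
  by rewrite kEn ltnn in kn.
- apply: (@bounded_cvg_L1 _ _ 1) => //.
  + by move=> n x _; rewrite indicE ger0_norm// lern1 leq_b1.
  (* At each point the indicators of the partial unions are eventually constant: equal to 1 once the
     index exceeds [k] if [x] lies in [F k], and always 0 if [x] lies in no [F k]. *)
  move=> x _; have [[k _ Fkx]|nFx] := pselect ((\bigcup_k F k) x).
    apply: cvg_near_cst; exists k.+1 => // n /= kn.
    rewrite !indicE !mem_set//; first by exists k.
    rewrite -bigcup_mkord; by exists k.
  apply: cvg_near_cst; apply: nearW => n.
  rewrite !indicE !memNset//; rewrite -bigcup_mkord => -[k _ Fkx].
  by apply: nFx; exists k.
Qed.

(** Simple functions converge to [f] in L1, and each of them is a finite linear combination of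
    indicators of its level sets. *)
Lemma L1_closure_integrable (f : T -> R) : measurable_fun D f ->
  mu.-integrable D (EFin \o f) -> L1_closure f.
Proof.
move=> mf /(approximation_sfun_integrable mD)[g [_ _ fg]].
have mg n : measurable_fun D (g n) by exact: measurable_funTS.
apply: (@L1_closure_cvg (fun n => g n)) => // n.
pose h : T -> R := g n.
have mp z : measurable (h @^-1` [set z]) by exact: measurable_funPTI.
rewrite (_ : (g n : T -> R) =
    (fun x => \sum_(y <- fset_set (range h)) y * \1_(h @^-1` [set y]) x)); last first.
  by apply/funext => x; rewrite fimfunE fsbig_finite.
(* Generalizing the range to an arbitrary list of values lets the sum be built one term at a
   time. *)
elim: (fset_set _ : seq R) => [|y s IH].
  rewrite (_ : (fun _ => _) = (fun x => 0 * \1_setT x)).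
    by apply: L1_closureZ => //; exact: mindic.
  by apply/funext => x; rewrite big_nil mul0r.
rewrite (_ : (fun _ => _) = (fun x => y * \1_(h @^-1` [set y]) x) \+
  (fun x => \sum_(z <- s) z * \1_(h @^-1` [set z]) x)).
  apply: L1_closureD => //.
  - by apply: measurable_funM => //; exact: mindic.
  - by apply: measurable_sum => z; apply: measurable_funM => //; exact: mindic.
  - by apply: L1_closureZ; [exact: mindic|exact: L1_closure_indic].
by apply/funext => x; rewrite big_cons.
Qed.

End L1_density.

(** * Lebesgue measure on row vectors *)

(** The image of Lebesgue measure under the translation gives half-open intervals their length, and
    this determines the measure. *)
Lemma lebesgue_measureD {R : realType} (a : R) (A : set R) : measurable A ->
  lebesgue_measure ((fun x => x + a) @^-1` A) = lebesgue_measure A.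
Proof.
move=> mA.
have mf : measurable_fun setT (fun x : measurableTypeR R => (x + a : measurableTypeR R)).
  exact: measurable_funD.
pose m := measure_function_pushforward__canonical__measure_function_Measure
  (@lebesgue_measure R) mf.
have -> : lebesgue_measure ((fun x => x + a) @^-1` A) = m A by [].
apply/esym/lebesgue_measure_unique => // _ [[b c]] _ <- /=.
rewrite /pushforward (_ : _ @^-1` _ = `]b - a, c - a]%classic); last first.
  by apply/seteqP; split => x /=; rewrite !in_itv/= ltrBlDr lerBrDr.
rewrite !lebesgue_measure_itv/= !lte_fin ltrD2r; case: ifPn => // bc.
by rewrite -!EFinB opprB addrA subrK.
Qed.

Lemma cons_rVD {R : realType} n (v : 'rV[R]_n.+1) (p : R * 'rV[R]_n) :
  cons_rV p + v = cons_rV (p.1 + v ord0 ord0, p.2 + \row_i v ord0 (lift ord0 i)).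
Proof.
apply/rowP => i; rewrite /cons_rV !mxE; case: splitP => j ji; rewrite !mxE/=.
  by congr (_ + v _ _); apply/val_inj => /=; rewrite ji ord1.
by congr (_ + v _ _); apply/val_inj.
Qed.

Lemma measurable_translation_rV {R : realType} n (v : 'rV[R]_n) :
  measurable_fun setT (fun x : 'rV[R]_n => x + v).
Proof.
apply: measurable_fun_rV => i; under eq_fun do rewrite mxE.
by apply: measurable_funD => //; exact: measurable_coord_rV.
Qed.

(** Induction on the dimension: through [cons_rV], a translation acts on the two factors separately,
    and a product measure is determined by its values on rectangles. *)
Lemma lebesgue_rVD {R : realType} n (v : 'rV[R]_n) (A : set 'rV[R]_n) : measurable A ->
  lebesgue_rV n ((fun x => x + v) @^-1` A) = lebesgue_rV n A.
Proof.
elim: n v A => [|n IH] v A mA.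
  congr (_ _); apply/seteqP; split => x /=.
    by rewrite (_ : x + v = x)//; apply/rowP => -[].
  by rewrite (_ : x + v = x)//; apply/rowP => -[].
rewrite /= /lebesgue_rV_step /pushforward.
set t : measurableTypeR R * 'rV[R]_n -> measurableTypeR R * 'rV[R]_n :=
  fun p => (p.1 + v ord0 ord0, p.2 + \row_i v ord0 (lift ord0 i)).
have mt : measurable_fun setT t.
  apply/measurable_fun_pair.
    by apply: measurable_funD => //; exact: measurable_fst.
  exact: (measurableT_comp (measurable_translation_rV _) measurable_snd).
have -> : @cons_rV R n @^-1` ((fun x => x + v) @^-1` A) = t @^-1` (@cons_rV R n @^-1` A).
  by apply/seteqP; split => p /=; rewrite cons_rVD.
apply/esym.
apply: (@product_measure_unique _ _ _ _ R lebesgue_measure (lebesgue_rV n)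
  (measure_function_pushforward__canonical__measure_function_Measure
   (lebesgue_measure \x lebesgue_rV n)%E mt)) => [B C mB mC|].
  (* On a rectangle, the first factor is handled by invariance on the line and the second by the
     induction hypothesis. *)
  rewrite /= /pushforward.
  rewrite (_ : _ @^-1` _ = ((fun x => x + v ord0 ord0) @^-1` B) `*`
     ((fun x => x + \row_i v ord0 (lift ord0 i)) @^-1` C))//.
  rewrite product_measure1E//=; last 2 first.
  - by rewrite -[X in measurable X]setTI; apply: measurable_funD.
  - by rewrite -[X in measurable X]setTI; exact: measurable_translation_rV.
  by rewrite lebesgue_measureD// IH.
by rewrite -[X in measurable X]setTI; exact: measurable_cons_rV.
Qed.

(** The cube is described by its coordinates so that its preimage under [cons_rV] is an interval
    times a cube of one dimension less. *)
Lemma lebesgue_rV_box {R : realType} n (M : R) :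
  measurable [set x : 'rV[R]_n | forall i, `|x ord0 i| <= M] /\
  (lebesgue_rV n [set x : 'rV[R]_n | forall i, (`|x ord0 i| <= M)%R] < +oo)%E.
Proof.
have mbox k : measurable [set x : 'rV[R]_k | forall i, `|x ord0 i| <= M].
  rewrite (_ : mkset _ = \bigcap_(i in [set: 'I_k])
     ((fun x : 'rV[R]_k => x ord0 i) @^-1` `[- M, M]%classic)); last first.
    apply/seteqP; split => [x xM i _ |x xM i] /=.
      by rewrite in_itv/= -ler_norml.
    by have := xM i I; rewrite /= in_itv/= -ler_norml.
  apply: fin_bigcap_measurable; first exact: finite_finset.
  by move=> i _; rewrite -[X in measurable X]setTI; exact: measurable_coord_rV.
split => //; elim: n => [|n IH].
  by rewrite /= diracE ltry.
rewrite /= /lebesgue_rV_step /pushforward.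
rewrite (_ : _ @^-1` _ = `[-M, M]%classic `*` [set x : 'rV[R]_n | forall i, `|x ord0 i| <= M]).
  have Moo : (lebesgue_measure `[(- M)%R, M]%classic < +oo)%E.
    by rewrite lebesgue_measure_itv/=; case: ifPn => //; rewrite -EFinB ltry.
  rewrite product_measure1E//; last exact: mbox.
  by rewrite lte_mul_pinfty// ge0_fin_numE.
apply/seteqP; split => p /=.
  move=> pM; rewrite in_itv/= -ler_norml; split.
    have := pM ord0; rewrite /cons_rV mxE; case: splitP => j //= _.
    by rewrite mxE.
  move=> i; have := pM (lift ord0 i); rewrite /cons_rV mxE; case: splitP => j //=.
    by rewrite ord1.
  by rewrite /bump/= !add1n => -[] /val_inj ->.
rewrite in_itv/= -ler_norml => -[p1 p2] i.
by rewrite /cons_rV mxE; case: splitP => j _ //; rewrite mxE.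
Qed.

Lemma coord_le_mx_norm {R : realDomainType} m n (x : 'M[R]_(m, n)) i j :
  `|x i j| <= mx_norm x.
Proof.
rewrite mx_normE -[leLHS]nngE num_le.
exact: (@le_bigmax _ _ _ 0%:nng (fun k => `|x k.1 k.2|%:nng) (i, j)).
Qed.

Lemma lebesgue_rV_bounded {R : realType} n (W : set 'rV[R]_n) :
  measurable W -> bounded_set W -> (lebesgue_rV n W < +oo)%E.
Proof.
move=> mW [M [_ MW]]; have [mB Boo] := lebesgue_rV_box n (M + 1).
apply: le_lt_trans Boo; apply: le_measure; [exact: mem_set..|].
move=> x Wx i; apply: le_trans (MW (M + 1) _ x Wx); last by rewrite ltrDl.
exact: coord_le_mx_norm.
Qed.

(** * Test functions *)

Lemma continuous_measurable_rV {R : realType} n (f : 'rV[R]_n -> R) :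
  continuous f -> measurable_fun setT f.
Proof.
move=> cf; apply: (@measurability _ _ _ _ setT _ (@RGenOInfty.G R)).
  exact: RGenOInfty.measurableE.
move=> _ [_ [a ->] <-]; rewrite setTI; apply: open_measurable_rV.
by apply: open_comp => [x _|]; [exact: cf|exact: interval_open].
Qed.

(** * Directional derivatives along a line *)

Section line.
Context {R : realType} {V : normedModType R}.
Variables (f : V -> R) (e : V).
Hypothesis df : forall x, derivable f x e.

Lemma is_derive_line (x : V) (t : R) :
  is_derive t 1 (fun s => f (x + s *: e)) ('D_e f (x + t *: e)).
Proof.
(* The difference quotient of the restriction to the line at [t] is, as a function of [h], the one
   of [f] at [x + t *: e] in direction [e]. *)
have E : (fun h : R => h^-1 *: (f (x + (h *: (1 : R) + t) *: e) - f (x + t *: e))) =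
         (fun h : R => h^-1 *: (f (h *: e + (x + t *: e)) - f (x + t *: e))).
  apply/funext => h; congr (_ *: (f _ - _)).
  by rewrite scalerDl addrCA; congr (_ *: _ + _); exact: mulr1.
split; first by rewrite /derivable [X in X @ _]E; exact: df.
by rewrite /derive [X in X @ _]E.
Qed.

Lemma line_lipschitz (C : R) (x : V) (t : R) : (forall x, `|'D_e f x| <= C) ->
  0 <= t -> `|f (x + t *: e) - f x| <= C * t.
Proof.
move=> dC t0.
have [|c _ ] := @MVT_segment R (fun s => f (x + s *: e))
    (fun s => 'D_e f (x + s *: e)) 0 t t0 (fun s _ => is_derive_line x s).
  apply: continuous_subspaceT => s.
  apply/differentiable_continuous/derivable1_diffP.
  by have [] := is_derive_line x s.
rewrite scale0r addr0 subr0 => ->.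
by rewrite normrM (ger0_norm t0) ler_wpM2r.
Qed.

(** Sampling at the steps [1 / (k + 1)] gives a sequence, the form that dominated convergence
    takes. *)
Lemma cvg_difference_quotient (x : V) :
  k.+1%:R * (f (x + k.+1%:R^-1 *: e) - f x) @[k --> \oo] --> 'D_e f x.
Proof.
have hcvg : k.+1%:R^-1 @[k --> \oo] --> (0 : R)^'.
  move=> A [r /= r0 rA]; have [k _ kA] : \forall k \near \oo, `|0 - k.+1%:R^-1 : R| < r.
    by have /cvgrPdist_lt := @cvg_harmonic R; exact.
  by exists k => // j /kA kj; apply: (rA _ kj); rewrite invr_neq0.
have dfx : (fun h : R => h^-1 *: (f (h *: e + x) - f x)) @ 0^' --> 'D_e f x.
  exact: df.
have := cvg_comp _ _ hcvg dfx; apply: cvg_trans; apply: near_eq_cvg.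
by apply: nearW => k; rewrite /= invrK [x + _]addrC.
Qed.

End line.

Lemma open_norm_gt {R : realType} {V : normedModType R} (M : R) :
  open [set x : V | M < `|x|].
Proof.
apply: (@open_comp _ _ (fun x : V => `|x|) [set r | M < r]); last exact: open_gt.
by move=> x _; exact: norm_continuous.
Qed.

Lemma integral_scale_diff d (T : measurableType d) {R : realType}
    (mu : {measure set T -> \bar R}) (D : set T) (f g : T -> R) (c : R) :
  measurable D -> mu.-integrable D (EFin \o f) -> mu.-integrable D (EFin \o g) ->
  (\int[mu]_(x in D) (c * (f x - g x))%:E =
   c%:E * (\int[mu]_(x in D) (f x)%:E - \int[mu]_(x in D) (g x)%:E))%E.
Proof.
move=> mD fi gi; rewrite -[X in (_ * X)%E](integralB mD fi gi).
by rewrite -(integralZl mD (integrableB mD fi gi)).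
Qed.

Lemma integral_scale_indic d (T : measurableType d) {R : realType}
    (mu : {measure set T -> \bar R}) (W : set T) (c : R) :
  0 <= c -> measurable W -> (\int[mu]_x (c * \1_W x)%:E = c%:E * mu W)%E.
Proof.
move=> c0 mW; under eq_integral do rewrite EFinM.
rewrite ge0_integralZl_EFin ?integral_indic ?setIT//.
by apply/measurable_EFinP.
Qed.

Lemma integrable_scale_indic d (T : measurableType d) {R : realType}
    (mu : {measure set T -> \bar R}) (W : set T) (c : R) :
  0 <= c -> measurable W -> (mu W < +oo)%E ->
  mu.-integrable setT (fun x => (c * \1_W x)%:E).
Proof.
move=> c0 mW Woo; apply/integrableP; split.
  by apply/measurable_EFinP; exact: measurable_funM.
under eq_integral do rewrite gee0_abs ?lee_fin ?mulr_ge0//.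
by rewrite integral_scale_indic// lte_mul_pinfty.
Qed.

Section test_functions.
Context {R : realType} {N : nat}.
Implicit Types (W : set 'rV[R]_N) (v phi : 'rV[R]_N -> R).
Local Notation leb := (@lebesgue_rV R N).

Lemma C1c_eq0 W phi x : C1c W phi -> ~ W x -> phi x = 0.
Proof.
move=> [_ _ _ _ sW] nWx; apply/eqP/negP => /negP phix.
by apply/nWx/sW/subset_closure.
Qed.

Lemma derive_eq0_off_support phi i x :
  ~ closure [set x | phi x != 0] x -> 'D_'e_i phi x = 0.
Proof.
move=> nx; rewrite (@near_eq_derive _ _ _ phi (cst 0)) ?derive_cst//.
have : open_nbhs x (~` closure [set x | phi x != 0]).
  by split => //; apply: closed_openC; exact: closed_closure.
move/open_nbhs_nbhs; apply: filterS => y ny.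
by apply/eqP/negP => /negP phiy; exact/ny/subset_closure.
Qed.

Lemma C1c_support_bounded W phi : C1c W phi ->
  exists M : R, forall x, M < `|x| -> phi x = 0.
Proof.
move=> [_ _ _ /compact_bounded[M [_ MS]] _].
exists (`|M| + 1) => x Mx.
have M1 : M < `|M| + 1 by rewrite (le_lt_trans (ler_norm _))// ltrDl.
apply/eqP/negP => /negP phix; have := MS _ M1 x (@subset_closure _ [set x | phi x != 0] x phix).
by rewrite /= leNgt Mx.
Qed.

(** On the compact support the continuous derivative is bounded; off it the derivative vanishes. *)
Lemma C1c_derive_bounded W phi i : C1c W phi ->
  exists2 C : R, 0 <= C & forall x, `|'D_'e_i phi x| <= C.
Proof.
move=> phiC; have [_ _ cD cS _] := phiC.
have /compact_bounded[M [_ MD]] : compact ('D_'e_i phi @` closure [set x | phi x != 0]).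
  by apply: continuous_compact => //; apply: continuous_subspaceT; exact: cD.
exists (`|M| + 1) => [|x]; first by rewrite addr_ge0.
have [Sx|nSx] := pselect (closure [set x | phi x != 0] x).
  apply: MD; last by exists x.
  by rewrite (le_lt_trans (ler_norm _))// ltrDl.
by rewrite (derive_eq0_off_support _ nSx) normr0 addr_ge0.
Qed.

Lemma integrable_bounded_support (f : 'rV[R]_N -> R) (C M : R) :
  measurable_fun setT f -> (forall x, `|f x| <= C) ->
  (forall x, M < `|x| -> f x = 0) -> leb.-integrable setT (EFin \o f).
Proof.
move=> mf fC f0; have [mB Boo] := lebesgue_rV_box N M.
set B := [set x | _] in mB Boo.
have mC : measurable_fun setT (fun x : 'rV[R]_N => C * \1_B x : R).
  by apply: measurable_funM.
apply: (@le_integrable _ _ _ _ _ measurableT _ (EFin \o (fun x => C * \1_B x))).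
- exact/measurable_EFinP.
- move=> x _ /=; rewrite lee_fin.
  have [Bx|nBx] := pselect (B x).
    by rewrite indicE mem_set// mulr1 (le_trans (fC x))// ler_norm.
  rewrite f0 ?normr0// ltNge; apply/negP => xM; apply: nBx => i.
  by rewrite (le_trans _ xM)//; exact: coord_le_mx_norm.
- by apply: integrable_scale_indic => //; exact: le_trans (fC 0).
Qed.

Lemma integral_translation (f : 'rV[R]_N -> R) (a : 'rV[R]_N) :
  measurable_fun setT f ->
  leb.-integrable setT (fun x => (f (x + a))%:E) ->
  (\int[leb]_x (f (x + a))%:E = \int[leb]_x (f x)%:E)%E.
Proof.
move=> mf intf; have mt := measurable_translation_rV a.
have := @integral_pushforward _ _ _ _ R _ mt leb setT (EFin \o f).
rewrite preimage_setT => /= <-//; last exact/measurable_EFinP.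
by apply: eq_measure_integral => A mA _; exact: lebesgue_rVD.
Qed.


Lemma C1c_derive_integrable W v phi i (B : R) :
  measurable_fun setT v -> (forall x, `|v x| <= B) -> C1c W phi ->
  leb.-integrable setT (fun x => (v x * 'D_'e_i phi x)%:E).
Proof.
move=> mv vB phiC; have [C C0 DC] := C1c_derive_bounded i phiC.
have [M phiM] := C1c_support_bounded phiC.
have [_ _ cD _ _] := phiC.
apply: (@integrable_bounded_support _ (B * C) M).
- by apply: measurable_funM => //; exact: continuous_measurable_rV.
- by move=> x; rewrite normrM ler_pM.
move=> x Mx; rewrite (@near_eq_derive _ _ _ phi (cst 0)) ?derive_cst ?mulr0//.
have /open_nbhs_nbhs : open_nbhs x [set y : 'rV[R]_N | M < `|y|].
  by split => //; exact: open_norm_gt.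
by apply: filterS => y; exact: phiM.
Qed.

(* Integration by parts at the level of difference quotients: the increment is
   moved from [phi] to [v] by translation invariance. *)
Lemma integral_lipschitz_derive W v phi i (B K : R) :
  measurable W -> (leb W < +oo)%E -> 0 <= K ->
  measurable_fun setT v -> (forall x, `|v x| <= B) ->
  (forall x t, `|v (x + t *: 'e_i) - v x| <= K * `|t|) ->
  C1c W phi -> (forall x, `|phi x| <= 1) ->
  (\int[leb]_x (v x * 'D_'e_i phi x)%:E <= K%:E * leb W)%E.
Proof.
move=> mW Woo K0 mv vB vK phiC phi1; have [C C0 DC] := C1c_derive_bounded i phiC.
have [M phiM] := C1c_support_bounded phiC.
have [cphi dphi _ _ _] := phiC.
have B0 : 0 <= B by apply: le_trans (vB 0).
have mphi := continuous_measurable_rV cphi.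
pose h k : R := k.+1%:R^-1.
have h0 k : 0 < h k by rewrite invr_gt0.
have h1 k : h k <= 1 by rewrite invf_le1// ler1n.
pose q k (x : 'rV[R]_N) := k.+1%:R * (phi (x + h k *: 'e_i) - phi x).
have mshift k : measurable_fun setT (fun x : 'rV[R]_N => phi (x + h k *: 'e_i)).
  exact: (measurableT_comp mphi (measurable_translation_rV _)).
have mvshift k : measurable_fun setT (fun x : 'rV[R]_N => v (x - h k *: 'e_i)).
  exact: (measurableT_comp mv (measurable_translation_rV _)).
have mq k : measurable_fun setT (q k).
  by apply: measurable_funM => //; exact: measurable_funB.
(* The mean value theorem bounds the quotients uniformly in [k]. *)
have qC k x : `|q k x| <= C.
  rewrite normrM ger0_norm// mulrC -ler_pdivlMr//.
  exact: (line_lipschitz (dphi i) _ DC (ltW (h0 k))).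
(* Since the steps are at most 1, all the shifted functions vanish outside one fixed ball. *)
have phiM' (x : 'rV[R]_N) k : M + `|'e_i : 'rV[R]_N| < `|x| -> phi (x + h k *: 'e_i) = 0.
  move=> Mx; apply: phiM; rewrite -(ltrD2r `|'e_i : 'rV[R]_N|) (lt_le_trans Mx)//.
  have := ler_normB (x + h k *: 'e_i) (h k *: 'e_i); rewrite addrK => /le_trans; apply.
  by rewrite lerD2l normrZ ger0_norm ?ler_piMl// ltW.
pose F1 k (x : 'rV[R]_N) := v x * phi (x + h k *: 'e_i).
pose F2 (x : 'rV[R]_N) := v x * phi x.
pose F1' k (x : 'rV[R]_N) := v (x - h k *: 'e_i) * phi x.
have iF1 k : leb.-integrable setT (EFin \o F1 k).
  apply: (@integrable_bounded_support _ (B * 1) (M + `|'e_i : 'rV[R]_N|)).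
  - exact: measurable_funM.
  - by move=> x; rewrite normrM ler_pM.
  - by move=> x Mx; rewrite /F1 phiM' ?mulr0.
have iF2 : leb.-integrable setT (EFin \o F2).
  apply: (@integrable_bounded_support _ (B * 1) M).
  - exact: measurable_funM.
  - by move=> x; rewrite normrM ler_pM.
  - by move=> x Mx; rewrite /F2 phiM ?mulr0.
have iF1' k : leb.-integrable setT (EFin \o F1' k).
  apply: (@integrable_bounded_support _ (B * 1) M).
  - exact: measurable_funM.
  - by move=> x; rewrite normrM ler_pM.
  - by move=> x Mx; rewrite /F1' phiM ?mulr0.
(* Translating by [h k *: 'e_i] passes the shift from [phi] to [v]. *)
have F1E k : (\int[leb]_x (F1 k x)%:E = \int[leb]_x (F1' k x)%:E)%E.
  rewrite -(@integral_translation (F1' k) (h k *: 'e_i)).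
  - by apply: eq_integral => x _; rewrite /F1' addrK.
  - exact: measurable_funM.
  - by under eq_fun do rewrite /F1' addrK; exact: iF1.
have qE k : (\int[leb]_x (v x * q k x)%:E =
    \int[leb]_x (k.+1%:R * (F1' k x - F2 x))%:E)%E.
  rewrite (integral_scale_diff _ measurableT (iF1' k) iF2) -F1E.
  rewrite -(integral_scale_diff _ measurableT (iF1 k) iF2).
  by apply: eq_integral => x _; rewrite /q mulrCA mulrBr.
set M' := M + `|'e_i : 'rV[R]_N|.
pose S := [set x : 'rV[R]_N | `|x| <= M'].
have mS : measurable S.
  rewrite (_ : S = ~` [set x | M' < `|x|]).
    apply: measurableC; apply: open_measurable_rV.
    exact: open_norm_gt.
  by apply/seteqP; split => x /=; [move/le_gtF => ->|move/negP; rewrite -leNgt].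
(* A dominating function for all the products [v x * q k x]: a constant on the ball that contains
   every support. *)
have ig : leb.-integrable setT (EFin \o (fun x => B * C * \1_S x)).
  apply: (@integrable_bounded_support _ (B * C) M') => //.
  - exact: measurable_funM.
  - move=> x; rewrite normrM ger0_norm ?mulr_ge0// ler_piMr ?mulr_ge0//.
    by rewrite indicE ger0_norm// lern1 leq_b1.
  - by move=> x Mx; rewrite indicE memNset ?mulr0// /S /= leNgt Mx.
have [|||||_ _ ccvg] := @dominated_convergence _ _ R leb setT measurableT
  (fun k x => (v x * q k x)%:E) (fun x => (v x * 'D_'e_i phi x)%:E)
  (EFin \o (fun x => B * C * \1_S x)).
- by move=> k; apply/measurable_EFinP; exact: measurable_funM.
- exact: measurable_int (C1c_derive_integrable i mv vB phiC).
- apply: aeW => x _; apply: cvg_EFin; first exact: nearW.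
  apply: cvgM; first exact: cvg_cst.
  by apply: cvg_difference_quotient; exact: dphi.
- exact: ig.
- apply: aeW => x k _ /=; rewrite lee_fin normrM.
  have [xM|Mx] := leP `|x| M'; first by rewrite indicE mem_set// mulr1 ler_pM.
  rewrite /q phiM'// phiM ?(le_lt_trans _ Mx)// ?lerDl//.
  by rewrite subrr mulr0 normr0 mulr0 !mulr_ge0.
(* It now suffices to bound the integral for each [k]. *)
rewrite -(cvg_lim _ ccvg)//; apply: lime_le; first exact: cvgP ccvg.
apply: nearW => k; rewrite /= qE -integral_scale_indic//.
apply: le_integral => //.
- exact: (integrableZl measurableT _ (integrableB measurableT (iF1' k) iF2)).
- exact: integrable_scale_indic.
(* Off [W] both sides are 0. On [W] the increment of [v] is at most [K * h k], and the factor
   [k + 1] cancels [h k]. *)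
move=> x _; rewrite lee_fin /F1' /F2 -mulrBl.
have [Wx|nWx] := pselect (W x); last first.
  by rewrite (C1c_eq0 phiC nWx) !mulr0 indicE memNset ?mulr0.
rewrite indicE mem_set// mulr1 (le_trans (ler_norm _))// !normrM.
rewrite mulrA; apply: (le_trans (ler_piMr _ (phi1 x))); first exact: mulr_ge0.
rewrite -scaleNr (le_trans (ler_wpM2l _ (vK _ _)))// normrN !ger0_norm ?(ltW (h0 k))//.
by rewrite mulrCA mulfV ?mulr1.
Qed.

End test_functions.

(** * Lipschitz functions *)

Section distance.
Context {R : realType} {V : normedModType R}.
Variable A : set V.
Hypothesis A0 : A !=set0.

Definition set_dist (x : V) : R := inf [set `|x - y| | y in A].

Lemma has_inf_set_dist x : has_inf [set `|x - y| | y in A].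
Proof.
split; first by have [a Aa] := A0; exists `|x - a|, a.
by exists 0 => _ [y _ <-].
Qed.

Lemma set_dist_ge0 x : 0 <= set_dist x.
Proof.
apply: lb_le_inf; first by have [] := has_inf_set_dist x.
by move=> _ [y _ <-].
Qed.

Lemma set_dist_mem x : A x -> set_dist x = 0.
Proof.
move=> Ax; apply/eqP; rewrite eq_le set_dist_ge0 andbT.
apply: ge_inf; first by have [] := has_inf_set_dist x.
by exists x => //; rewrite subrr normr0.
Qed.

Lemma set_dist_lipschitz x y : `|set_dist x - set_dist y| <= `|x - y|.
Proof.
suff H a b : set_dist a - set_dist b <= `|a - b|.
  by rewrite ler_norml H andbT lerNl opprB distrC H.
rewrite lerBlDl -lerBlDr.
apply: lb_le_inf; first by have [] := has_inf_set_dist b.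
move=> _ [c Ac <-]; rewrite lerBlDr.
apply: (@le_trans _ _ `|a - c|); last by rewrite [leRHS]addrC ler_distD.
by apply: ge_inf; [have [] := has_inf_set_dist a|exists c].
Qed.

Lemma set_dist_continuous : continuous set_dist.
Proof.
move=> x; apply/cvgrPdist_lt => e e0; apply/nbhs_ballP; exists e => //= y; rewrite -ball_normE /=.
exact: le_lt_trans (set_dist_lipschitz _ _).
Qed.

(** A ball around [x] that misses [A] has its radius as a lower bound of the distances. *)
Lemma set_dist_gt0 x : open (~` A) -> ~ A x -> 0 < set_dist x.
Proof.
move=> oA nAx; have /nbhs_ballP[r /= r0 rA] : nbhs x (~` A).
  by apply: open_nbhs_nbhs; split.
apply: (lt_le_trans r0); apply: lb_le_inf.
  by have [] := has_inf_set_dist x.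
move=> _ [y Ay <-]; rewrite leNgt; apply/negP => xy.
by apply: (rA y) => //; rewrite -ball_normE.
Qed.

End distance.

Section lipschitz.
Context {R : realType} {N : nat}.
Local Notation leb := (@lebesgue_rV R N).

(** Increments are controlled along the coordinate axes, as in the integration by parts for partial
    derivatives; one [K] bounds both the values and the increments. *)
Definition coord_lipschitz : set ('rV[R]_N -> R) :=
  [set v : 'rV[R]_N -> R | measurable_fun setT v /\ exists K : R, (forall x, `|v x| <= K) /\
     forall i x t, `|v (x + t *: 'e_i) - v x| <= K * `|t|].

Lemma coord_lipschitzD v w :
  coord_lipschitz v -> coord_lipschitz w -> coord_lipschitz (v \+ w).
Proof.
move=> [mv [K [vK vL]]] [mw [L [wL wLip]]]; split; first exact: measurable_funD.
exists (K + L); split => [x|i x t].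
  by rewrite (le_trans (ler_normD _ _))// lerD.
by rewrite /= opprD addrACA (le_trans (ler_normD _ _))// mulrDl lerD.
Qed.

Lemma coord_lipschitzZ (c : R) v :
  coord_lipschitz v -> coord_lipschitz (fun x => c * v x).
Proof.
move=> [mv [K [vK vL]]]; split; first exact: measurable_funM.
exists (`|c| * K); split => [x|i x t].
  by rewrite normrM ler_wpM2l.
by rewrite -mulrBr normrM -mulrA ler_wpM2l.
Qed.

Lemma coord_lipschitz1 : coord_lipschitz \1_setT.
Proof.
split => //; exists 1; split => [x|i x t].
  by rewrite indicT normr1.
by rewrite !indicT subrr normr0 mul1r.
Qed.

(** For closed [A] these truncated distances tend pointwise to the indicator of the complement of
    [A] as [k] grows. *)
Lemma coord_lipschitz_min1_dist (A : set 'rV[R]_N) (k : nat) : A !=set0 ->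
  coord_lipschitz (fun x => Num.min 1 (k%:R * set_dist A x)).
Proof.
move=> A0; split.
  apply: measurable_minr => //; apply: measurable_funM => //.
  by apply: continuous_measurable_rV; exact: set_dist_continuous.
(* Summing the norms of all basis vectors gives one constant valid for every direction [i]. *)
pose L : R := \sum_(i < N) `|'e_i : 'rV[R]_N|.
exists (1 + k%:R * L); split => [x|i x t].
  rewrite ger0_norm ?le_min ?ler01 ?mulr_ge0 ?set_dist_ge0//.
  by rewrite ge_min lerDl mulr_ge0 ?sumr_ge0.
have minL (a b : R) : `|Num.min 1 a - Num.min 1 b| <= `|a - b|.
  rewrite /Num.min; case: ltP => ?; case: ltP => ?; rewrite ?subrr ?normr0//;
  rewrite ler_norml; apply/andP; split; have := ler_norm (a - b);
    have := ler_norm (b - a); rewrite (distrC b a); lra.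
apply: (le_trans (minL _ _)); rewrite -mulrBr normrM ger0_norm//.
rewrite mulrDl mul1r (@le_trans _ _ (k%:R * L * `|t|)) ?lerDr//.
rewrite -mulrA ler_wpM2l// (le_trans (set_dist_lipschitz _ _ _))//.
rewrite addrAC subrr add0r normrZ mulrC ler_wpM2r//.
by rewrite /L (bigD1 i)//= lerDl sumr_ge0.
Qed.

(** The open sets form a pi-system generating the Borel sets, and the indicator of an open [U] is
    the bounded pointwise limit of truncated multiples of the distance to its complement. *)
Lemma coord_lipschitz_dense (W : set 'rV[R]_N) (f : 'rV[R]_N -> R) :
  measurable W -> (leb W < +oo)%E ->
  measurable_fun W f -> leb.-integrable W (EFin \o f) ->
  L1_closure leb W coord_lipschitz f.
Proof.
move=> mW Woo; have Vm v : coord_lipschitz v -> measurable_fun W v.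
  by move=> [mv _]; exact: measurable_funTS.
have V1 : L1_closure leb W coord_lipschitz \1_setT.
  move=> e e0; exists (\1_setT); first exact: coord_lipschitz1.
  rewrite /L1_dist; under eq_integral do rewrite subrr normr0.
  by rewrite integral0 lte_fin.
apply: (@L1_closure_integrable _ _ _ leb W mW _ Vm coord_lipschitzD
  coord_lipschitzZ open erefl (@openI _) V1 _ Woo) => U oU.
(* The whole space is set apart because [set_dist] is used for a nonempty set, here the complement
   of [U]. *)
have [->//|/eqP/setTPn[a Ua]] := pselect (U = setT).
have A0 : (~` U) !=set0 by exists a.
have mv k := (coord_lipschitz_min1_dist k A0).1.
have mU : measurable U by exact: open_measurable_rV.
apply: (@L1_closure_cvg _ _ _ leb W mW _ Vm
    (fun k x => Num.min 1 (k%:R * set_dist (~` U) x))).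
- by move=> k; exact: measurable_funTS.
- exact: measurable_indic.
- move=> k e e0; exists (fun x => Num.min 1 (k%:R * set_dist (~` U) x)).
    exact: coord_lipschitz_min1_dist.
  rewrite /L1_dist; under eq_integral do rewrite subrr normr0.
  by rewrite integral0 lte_fin.
apply: (@bounded_cvg_L1 _ _ _ leb W mW _ _ 1) => //.
- by move=> k; exact: measurable_funTS.
- move=> k x _; rewrite ger0_norm ?le_min ?ler01 ?mulr_ge0 ?set_dist_ge0//.
  by rewrite ge_min lexx.
move=> x _; have [Ux|nUx] := pselect (U x).
  have d0 : 0 < set_dist (~` U) x.
    by apply: set_dist_gt0 => //; rewrite setCK.
  (* Once [k] exceeds the inverse of the distance, the minimum equals 1. *)
  apply: cvg_near_cst; exists (Num.truncn (set_dist (~` U) x)^-1).+1 => // k /= tk.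
  rewrite indicE mem_set// min_l// -ler_pdivrMr// mul1r.
  by rewrite (le_trans (ltW (truncnS_gt _)))// ler_nat.
apply: cvg_near_cst; apply: nearW => k.
by rewrite indicE memNset// set_dist_mem// mulr0 min_r.
Qed.

End lipschitz.

(** * Variation *)

Section variation_estimates.
Context {R : realType} {N : nat}.
Variable W : set 'rV[R]_N.
Hypotheses (mW : measurable W) (Woo : (lebesgue_rV N W < +oo)%E).
Implicit Types (u v w : 'rV[R]_N -> R) (phi : 'I_N -> 'rV[R]_N -> R).
Local Notation leb := (@lebesgue_rV R N).

Lemma Lq_norm1_dist u v : Lq_norm W 1 (u \- v) = L1_dist leb W u v.
Proof.
rewrite /Lq_norm Lnorm1 /L1_dist [RHS]integral_mkcond.
apply: eq_integral => x _; rewrite /= !patchE.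
by case: ifPn => //; rewrite normr0.
Qed.

Lemma Lq_norm1 u : Lq_norm W 1 u = (\int[leb]_(x in W) `|u x|%:E)%E.
Proof.
rewrite /Lq_norm Lnorm1 [RHS]integral_mkcond.
apply: eq_integral => x _; rewrite /= !patchE.
by case: ifPn => //; rewrite normr0.
Qed.

Lemma Lq1_integrable u : Lq W 1 u -> leb.-integrable W (EFin \o u).
Proof.
move=> [mu uoo]; apply/integrableP; split; first exact/measurable_EFinP.
by rewrite Lq_norm1 in uoo.
Qed.

Lemma integrable_Lq1 u :
  measurable_fun W u -> leb.-integrable W (EFin \o u) -> Lq W 1 u.
Proof. by move=> mu /integrableP[_ uoo]; split => //; rewrite Lq_norm1. Qed.

Lemma divergence_eq0 phi x : (forall i, C1c W (phi i)) -> ~ W x ->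
  divergence phi x = 0.
Proof.
move=> phiC nWx; rewrite /divergence big1// => i _.
apply: derive_eq0_off_support.
by have [_ _ _ _ sW] := phiC i; move=> /sW.
Qed.

Lemma integrable_divergence u phi : (forall i, C1c W (phi i)) ->
  leb.-integrable W (EFin \o u) -> measurable_fun W u ->
  leb.-integrable W (fun x => (u x * divergence phi x)%:E).
Proof.
move=> phiC iu mu.
have /choice[C CP] (i : 'I_N) :
    exists c : R, 0 <= c /\ forall x, `|'D_'e_i (phi i) x| <= c.
  by have [c c0 cP] := C1c_derive_bounded i (phiC i); exists c.
have md : measurable_fun W (divergence phi).
  apply: measurable_sum => i; apply: measurable_funTS.
  by apply: continuous_measurable_rV; have [_ _ + _ _] := phiC i; exact.
apply: (le_integrable mW _ _ (integrableZl mW (\sum_i C i) iu)).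
  by apply/measurable_EFinP; exact: measurable_funM.
have C0 : 0 <= \sum_i C i by apply: sumr_ge0 => i _; have [] := CP i.
move=> x Wx; rewrite -EFinM !abse_EFin lee_fin !normrM mulrC ler_wpM2r//.
rewrite (ger0_norm C0) /divergence (le_trans (ler_norm_sum _ _ _))//.
by apply: ler_sum => i _; have [_] := CP i; exact.
Qed.

(** The zero field is an admissible test field. *)
Lemma Var_ge0 u : (0 <= Var W u)%E.
Proof.
apply: ereal_sup_ubound; exists (fun _ _ => 0) => /=.
  split => [i|x].
    have E : [set x : 'rV[R]_N | (0 : R) != 0] = set0.
      by apply/seteqP; split => x //=; rewrite eqxx.
    split; rewrite ?E ?closure0.
    - exact: cst_continuous.
    - by move=> j x; exact: derivable_cst.
    - move=> j; rewrite (_ : 'D_'e_j _ = cst 0); first exact: cst_continuous.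
      by apply/funext => x; exact: derive_cst.
    - exact: compact0.
    - exact: sub0set.
  rewrite /euclidean_norm big1 ?sqrtr0 ?ler01// => i _.
  by rewrite expr0n.
rewrite integral0_eq// => x _; rewrite /divergence big1 ?mulr0// => i _.
exact: derive_cst.
Qed.

Lemma convex_integrable t v w : leb.-integrable W (EFin \o v) ->
  leb.-integrable W (EFin \o w) ->
  leb.-integrable W (EFin \o (fun x => (1 - t) * v x + t * w x)).
Proof.
move=> iv iw.
exact: (integrableD mW (integrableZl mW (1 - t) iv) (integrableZl mW t iw)).
Qed.

(** For each fixed test field the integral is linear in the function, and a supremum of linear
    functionals is convex. *)
Lemma Var_convex t v w : 0 <= t <= 1 -> Lq W 1 v -> Lq W 1 w ->
  (Var W (fun x => (1 - t)%R * v x + t * w x)%R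
     <= (1 - t)%:E * Var W v + t%:E * Var W w)%E.
Proof.
move=> /andP[t0 t1] Lv Lw; apply: ge_ereal_sup => _ [phi [phiC phi1] <-].
have iv := integrable_divergence phiC (Lq1_integrable Lv) Lv.1.
have iw := integrable_divergence phiC (Lq1_integrable Lw) Lw.1.
have -> : (\int[leb]_(x in W) (((1 - t) * v x + t * w x) * divergence phi x)%:E =
  (1 - t)%:E * \int[leb]_(x in W) (v x * divergence phi x)%:E +
  t%:E * \int[leb]_(x in W) (w x * divergence phi x)%:E)%E.
  rewrite -(integralZl mW iv) -(integralZl mW iw).
  rewrite -(integralD mW (integrableZl mW _ iv) (integrableZl mW _ iw)).
  by apply: eq_integral => x _; rewrite -!EFinM -EFinD mulrDl !mulrA.
apply: leeD; apply: lee_wpmul2l; rewrite ?lee_fin ?subr_ge0//.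
  by apply: ereal_sup_ubound; exists phi.
by apply: ereal_sup_ubound; exists phi.
Qed.

(** Each of the [N] partial derivatives in the divergence contributes at most [K] times the measure
    of [W]. *)
Lemma coord_lipschitz_BV v : coord_lipschitz v -> BV W v.
Proof.
move=> [mv [K [vK vL]]].
have mvW : measurable_fun W v by exact: measurable_funTS.
have K0 : 0 <= K by apply: le_trans (vK 0).
have iv : leb.-integrable W (EFin \o v).
  apply: (@le_integrable _ _ _ leb W mW _ (cst K%:E)).
  - exact/measurable_EFinP.
  - by move=> x _; rewrite /= lee_fin (le_trans (vK x))// ler_norm.
  - apply/integrableP; split; first exact: measurable_cst.
    by rewrite integral_cst//= lte_mul_pinfty.
split; first exact: integrable_Lq1.
apply: (@le_lt_trans _ _ (\sum_(i < N) (K%:E * leb W))%E); last first.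
  by apply: lte_sum_pinfty => i _; rewrite lte_mul_pinfty.
apply: ge_ereal_sup => _ [phi [phiC phi1] <-].
have ii i : leb.-integrable setT (fun x => (v x * 'D_'e_i (phi i) x)%:E).
  exact: C1c_derive_integrable mv vK (phiC i).
(* The divergence vanishes off [W], so the integral may be taken over the whole space, where
   translation invariance applies. *)
rewrite integral_mkcond (_ : _ \_ W =
    (fun x => \sum_(i < N) (v x * 'D_'e_i (phi i) x)%:E)%E); last first.
  apply/funext => x; rewrite patchE sumEFin -mulr_sumr.
  case: ifPn => // /negP nWx.
  by rewrite -/(divergence phi x) divergence_eq0 ?mulr0// => /mem_set.
rewrite integral_sum//; apply: lee_sum => i _.
apply: (integral_lipschitz_derive mW Woo K0 mv vK (vL i) (phiC i)) => x.
(* Each component is bounded by the Euclidean norm of the field. *)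
apply: le_trans (phi1 x); rewrite -sqrtr_sqr ler_sqrt ?sumr_ge0//.
  by rewrite (bigD1 i)//= lerDl sumr_ge0// => j _; exact: sqr_ge0.
by move=> j _; exact: sqr_ge0.
Qed.

Lemma BV_dense u e : Lq W 1 u -> 0 < e ->
  exists2 w, BV W w & (L1_dist leb W u w < e%:E)%E.
Proof.
move=> Lu e0.
have [w Lw uw] := coord_lipschitz_dense mW Woo Lu.1 (Lq1_integrable Lu) e0.
by exists w => //; exact: coord_lipschitz_BV.
Qed.

(* If [v] is admissible for [u'] then, as [w] is closer than [eps] to [u], a
   convex combination of [v] and [w] with small weight on [w] is admissible for
   [u]. *)
Lemma eps1_Var_perturb (eps delta M : R) u u' w : 0 < eps -> 0 <= delta ->
  measurable_fun W u -> measurable_fun W u' -> BV W w ->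
  (L1_dist leb W u w <= (eps / 2)%:E)%E -> Var W w = M%:E ->
  (L1_dist leb W u u' <= delta%:E)%E ->
  (eps1_Var W eps u <= eps1_Var W eps u' + (delta * (M / (eps / 2)))%:E)%E.
Proof.
move=> eps0 delta0 mu mu' BVw uw VwM uu'.
have M0 : 0 <= M by rewrite -lee_fin -VwM Var_ge0.
have [Lw _] := BVw.
have e2 : 0 < eps / 2 by rewrite divr_gt0.
(* With the finite correction moved to the left, the claim is a lower bound on an infimum, which
   also covers the case of no admissible [v]. *)
rewrite -leeBlDr//; apply: le_ereal_inf_tmp => _ [v [BVv u'v] <-].
have [Lv Vvoo] := BVv.
rewrite Lq_norm1_dist in u'v.
rewrite leeBlDr//.
have d0 : 0 < eps / 2 + delta by rewrite ltr_wpDr.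
(* This weight solves [(1 - t) * (delta + eps) + t * (eps / 2) = eps]. *)
pose t := delta / (eps / 2 + delta).
have t0 : 0 <= t by rewrite divr_ge0// ltW.
have t1 : t <= 1 by rewrite ler_pdivrMr// mul1r lerDr ltW.
have t01 : 0 <= t <= 1 by rewrite t0.
have s0 : 0 <= 1 - t by rewrite subr_ge0.
pose z x := (1 - t) * v x + t * w x.
have iz : leb.-integrable W (EFin \o z).
  by apply: convex_integrable; exact: Lq1_integrable.
have mz : measurable_fun W z.
  by apply/measurable_EFinP; exact: measurable_int iz.
have Vz : (Var W z <= Var W v + (delta * (M / (eps / 2)))%:E)%E.
  apply: (le_trans (Var_convex t01 Lv Lw)); apply: leeD.
    by rewrite -[leRHS]mul1e lee_wpmul2r ?Var_ge0// lee_fin gerBl.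
  (* Dropping [delta] from the denominator of [t] makes the error linear in [delta]. *)
  rewrite VwM -EFinM lee_fin /t mulrAC -mulrA ler_wpM2l// ler_wpM2l//.
  by rewrite lef_pV2 ?posrE// lerDl.
apply: le_trans Vz; apply: ereal_inf_lbound; exists z => //.
split.
  split; first exact: integrable_Lq1.
  apply: (le_lt_trans (Var_convex t01 Lv Lw)).
  by rewrite VwM lte_add_pinfty// ?lte_mul_pinfty// -?EFinM ?ltry.
have uv : (L1_dist leb W u v <= (delta + eps)%:E)%E.
  by apply: (le_trans (L1_dist_triangle _ mW mu mu' Lv.1)); rewrite EFinD leeD.
rewrite Lq_norm1_dist.
(* Splitting [u] with the same weights compares it with [v] and [w] separately. *)
have uE : u = (fun x => (1 - t) * u x) \+ (fun x => t * u x).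
  by apply/funext => x /=; rewrite -mulrDl subrK mul1r.
rewrite {1}uE; apply: (@le_trans _ _ ((1 - t)%:E * L1_dist leb W u v +
   t%:E * L1_dist leb W u w)%E).
  rewrite -[X in (X%:E * L1_dist leb W u v)%E]ger0_norm//.
  rewrite -[X in (X%:E * L1_dist leb W u w)%E]ger0_norm//.
  rewrite -!L1_distZ//; [|exact: Lw.1|exact: Lv.1].
  by apply: L1_distD => //; apply: measurable_funM => //; [exact: Lv.1|exact: Lw.1].
apply: (@le_trans _ _ ((1 - t)%:E * (delta + eps)%:E + t%:E * (eps / 2)%:E)%E).
  by apply: leeD; apply: lee_wpmul2l; rewrite ?lee_fin.
rewrite -!EFinM -EFinD lee_fin le_eqVlt; apply/orP; left; apply/eqP.
rewrite /t; field.
by rewrite gt_eqF//; lra.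
Qed.

End variation_estimates.

(** * Lower semicontinuity *)

Theorem proposition3p16 (R : realType) (N : nat) (Omega : set 'rV[R]_N)
    (u_ : nat -> 'rV[R]_N -> R) (u : 'rV[R]_N -> R) :
  (0 < N)%N ->
  (N = 1%N -> forall i : 'I_N, is_interval [set x ord0 i | x in Omega]) ->
  open Omega -> bounded_set Omega -> BV_extension_domain Omega ->
  (forall n, Lq Omega 1 (u_ n)) -> Lq Omega 1 u ->
  Lq_norm Omega 1 (u_ n \- u) @[n --> \oo] --> 0%E ->
  forall eps : R, 0 < eps ->
    (eps1_Var Omega eps u <= limn_einf (fun n => eps1_Var Omega eps (u_ n)))%E.

Proof.
move=> _ _ oW bW _ Lu_ Lu u_u eps eps0.
have mW : measurable Omega by exact: open_measurable_rV.
have Woo := lebesgue_rV_bounded mW bW.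
have e2 : 0 < eps / 2 by rewrite divr_gt0.
have [w BVw uw] := BV_dense mW Woo Lu e2.
have [M VwM] : exists M, Var Omega w = M%:E.
  exists (fine (Var Omega w)); rewrite fineK// ge0_fin_numE ?Var_ge0//.
  by have [] := BVw.
have M0 : 0 <= M by rewrite -lee_fin -VwM Var_ge0.
pose c := M / (eps / 2); have c0 : 0 <= c by rewrite divr_ge0// ltW.
apply/lee_addgt0Pr => r r0; rewrite -leeBlDr// limn_einf_lim.
(* An L1 error of at most [r'] costs at most [r' * c <= r] in variation; adding 1 keeps the
   denominator positive when [c] is 0. *)
pose r' := r / (c + 1).
have r'0 : 0 < r' by rewrite divr_gt0// ltr_wpDl.
have : nbhs 0%E [set x : \bar R | (x < r'%:E)%E].
  by apply: open_ereal_lt'; rewrite lte_fin.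
(* The lower limit is the limit of the tail infima, so a bound valid for all [n >= m] passes to
   it. *)
move=> /u_u[m _ mP]; apply: lime_ge; first exact: is_cvg_einfs.
exists m => // k mk; apply: le_ereal_inf_tmp => _ [n kn <-].
rewrite leeBlDr//.
have un : (L1_dist (lebesgue_rV N) Omega u (u_ n) <= r'%:E)%E.
  have /ltW := mP n (leq_trans mk kn); rewrite /= Lq_norm1_dist.
  rewrite /L1_dist; under eq_integral do rewrite distrC; exact.
apply: (le_trans (eps1_Var_perturb mW eps0 (ltW r'0) Lu.1 (Lu_ n).1 BVw (ltW uw) VwM un)).
rewrite leeD2l// lee_fin -/c /r' -mulrA ler_piMr ?(ltW r0)//.
by rewrite mulrC ler_pdivrMr ?mul1r ?lerDl// ltr_wpDl.
Qed.
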